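(* Let $n\ge 2$. (i) Let $a\in\mathbb{Z}^n_{>0}$ with $\gcd(a_1,\dots,a_n)=1$ and let $c\in\mathbb{Q}^n$. Suppose that $(a,c)$ is generic. Then for $\tau=\tau(a,c)$ and $l=(l_1,\dots,l_{n-1})^T=l(a,c)$ we have $$\mathrm{Gap}(c,a)\ge \rho_{n-1}\,(a_\tau\, l_1\cdots l_{n-1})^{1/(n-1)}-\|l\|_1 .$$ (ii) For any $\epsilon>0$ there exist a vector $a\in\mathbb{Z}^n_{>0}$ with $\gcd(a_1,\dots,a_n)=1$ and $c\in\mathbb{Q}^n$ such that $(a,c)$ is generic and, with $\tau=\tau(a,c)$ and $l=l(a,c)$, $$\mathrm{Gap}(c,a)< (\rho_{n-1}+\epsilon)\,(a_\tau\, l_1\cdots l_{n-1})^{1/(n-1)}-\|l\|_1 .$$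
   Context: For $a\in\mathbb{Z}^n$, $b\in\mathbb{Z}$ let $P(a,b)=\{x\in\mathbb{R}^n_{\ge 0}: a^Tx=b\}$. For $c\in\mathbb{Q}^n$ let $IP(c,a,b)$ be the optimal value of $\min\{c^Tx: x\in P(a,b)\cap\mathbb{Z}^n\}$ and $LP(c,a,b)$ the optimal value of the linear programming relaxation $\min\{c^Tx: x\in P(a,b)\}$. Set $IG(c,a,b)=IP(c,a,b)-LP(c,a,b)$ and $\mathrm{Gap}(c,a)=\max_b IG(c,a,b)$, where $b$ ranges over all integers such that the integer problem is feasible and bounded. For $a\in\mathbb{Z}^n_{>0}$ with $\gcd(a_1,\dots,a_n)=1$ and $c\in\mathbb{Q}^n$, the pair $(a,c)$ is generic if for every positive $b\in\mathbb{Z}$ the linear programming relaxation has a unique optimal solution. For generic $(a,c)$, $\tau(a,c)$ is the unique index of the basic variable (the nonzero coordinate) of the optimal solution to the linear relaxation with a positive $b\in\mathbb{Z}$. Let $\pi_i:\mathbb{R}^n\to\mathbb{R}^{n-1}$ be the projection that forgets the $i$th coordinate, and set $l(a,c)=\pi_\tau(c)-c_\tau a_\tau^{-1}\pi_\tau(a)\in\mathbb{Q}^{n-1}$ with $\tau=\tau(a,c)$. Let $S^d=\{x\in\mathbb{R}^d_{\ge 0}: x_1+\cdots+x_d\le 1\}$ be the standard $d$-dimensional simplex. For a convex body $K\subset\mathbb{R}^d$ and a $d$-dimensional lattice $\Lambda\subset\mathbb{R}^d$, the covering radius is $\mu(K,\Lambda)=\min\{\mu>0: \mu K+\Lambda=\mathbb{R}^d\}$.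 The covering constant is $\rho_d=\inf\{\mu(S^d,\Lambda): \Lambda \text{ a } d\text{-dimensional lattice in } \mathbb{R}^d,\ \det(\Lambda)=1\}$. *)

(* Defs.v *)
(* Vectors of R^n are columns 'cV[R]_n. *)
From HB Require Import structures.
From mathcomp Require Import all_boot all_order all_algebra.
From mathcomp Require Import all_classical all_reals all_analysis.

Set Implicit Arguments.
Unset Strict Implicit.
Unset Printing Implicit Defensive.

Import Order.TTheory GRing.Theory Num.Theory.
Local Open Scope classical_set_scope.
Local Open Scope ring_scope.

Definition dot (R : pzRingType) n (u v : 'cV[R]_n) : R :=
  \sum_(i < n) u i 0 * v i 0.

Definition intvec (R : realType) n (a : 'cV[int]_n) : 'cV[R]_n :=
  map_mx intr a.

Definition ratvec (R : realType) n (c : 'cV[rat]_n) : 'cV[R]_n :=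
  map_mx ratr c.

Definition knapsack (R : realType) n (a : 'cV[int]_n) (b : int) :
    set 'cV[R]_n :=
  [set x : 'cV[R]_n | (forall i, 0 <= x i 0) /\ dot (intvec R a) x = b%:~R].
Arguments knapsack R {n} a b.

Definition Zn (R : realType) n : set 'cV[R]_n := range (@intvec R n).
Arguments Zn R n : clear implicits.

Definition IP_values (R : realType) n (c : 'cV[rat]_n) (a : 'cV[int]_n)
    (b : int) : set R :=
  [set dot (ratvec R c) x | x in knapsack R a b `&` Zn R n].
Arguments IP_values R {n} c a b.

Definition LP_values (R : realType) n (c : 'cV[rat]_n) (a : 'cV[int]_n)
    (b : int) : set R :=
  [set dot (ratvec R c) x | x in knapsack R a b].
Arguments LP_values R {n} c a b.

Definition IP (R : realType) n (c : 'cV[rat]_n) (a : 'cV[int]_n) (b : int) :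
    \bar R := ereal_inf (EFin @` IP_values R c a b).

Definition LP (R : realType) n (c : 'cV[rat]_n) (a : 'cV[int]_n) (b : int) :
    \bar R := ereal_inf (EFin @` LP_values R c a b).

Definition IG (R : realType) n (c : 'cV[rat]_n) (a : 'cV[int]_n) (b : int) :
    \bar R := (IP R c a b - LP R c a b)%E.

(* [has_inf]: the integer program is feasible (nonempty set of values) and
   bounded (from below).  The maximum over b is written as a supremum in the
   extended reals, so that no junk value can occur. *)
Definition Gap (R : realType) n (c : 'cV[rat]_n) (a : 'cV[int]_n) : \bar R :=
  ereal_sup [set IG R c a b | b in [set b | has_inf (IP_values R c a b)]].

Definition LP_optimal (R : realType) n (c : 'cV[rat]_n) (a : 'cV[int]_n)
    (b : int) (x : 'cV[R]_n) : Prop :=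
  knapsack R a b x /\
  forall y, knapsack R a b y -> dot (ratvec R c) x <= dot (ratvec R c) y.

Definition positive_vec n (a : 'cV[int]_n) : Prop := forall i, 0 < a i 0.

Definition gcd_vec n (a : 'cV[int]_n) : nat :=
  \big[gcdn/0%N]_(i < n) `|(a i 0)%R|%N.

Definition generic (R : realType) n (a : 'cV[int]_n) (c : 'cV[rat]_n) : Prop :=
  forall b : int, 0 < b -> exists! x : 'cV[R]_n, LP_optimal c a b x.

(* The index tau(a,c), as a predicate; [generic_tau] below shows that for a
   generic pair exactly one index satisfies it. *)
Definition is_tau (R : realType) n (a : 'cV[int]_n) (c : 'cV[rat]_n)
    (t : 'I_n) : Prop :=
  forall b : int, 0 < b -> forall x : 'cV[R]_n, LP_optimal c a b x ->
  forall i, (x i 0 != 0) = (i == t).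

(* [row' t] deletes the t-th coordinate. *)
Definition lvec n (a : 'cV[int]_n) (c : 'cV[rat]_n) (t : 'I_n) :
    'cV[rat]_n.-1 :=
  row' t c - (c t 0 / (a t 0)%:~R) *: row' t (map_mx intr a).

Definition norm1 n (u : 'cV[rat]_n) : rat := \sum_(i < n) `|u i 0|.

Definition simplex (R : realType) d : set 'cV[R]_d :=
  [set x : 'cV[R]_d | (forall i, 0 <= x i 0) /\ \sum_(i < d) x i 0 <= 1].
Arguments simplex R d : clear implicits.

(* The columns of B form a basis of the lattice; the absolute value of its
   determinant does not depend on the basis. *)
Definition lattice_with_det (R : realType) d (D : R) (L : set 'cV[R]_d) :
    Prop :=
  exists B : 'M[R]_d, [/\ B \in unitmx,
    L = [set B *m z | z in Zn R d] & `|\det B| = D].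

(* For a convex body K and a full-dimensional lattice L this infimum is taken
   over a nonempty set and is attained. *)
Definition covering_radius (R : realType) d (K L : set 'cV[R]_d) : R :=
  inf [set m | 0 < m /\ [set m *: k + y | k in K & y in L] = setT].

Definition rho (R : realType) d : R :=
  inf [set covering_radius (simplex R d) L | L in lattice_with_det 1].

Section GenericTau.
Context (R : realType) (n : nat).
Implicit Types (a : 'cV[int]_n) (c : 'cV[rat]_n) (x u v : 'cV[R]_n).

Let dotD u v x : dot u (v + x) = dot u v + dot u x.
Proof. by rewrite /dot -big_split/=; apply: eq_bigr => i _; rewrite mxE mulrDr. Qed.

Let dotZ u k x : dot u (k *: x) = k * dot u x.
Proof. by rewrite /dot mulr_sumr; apply: eq_bigr => i _; rewrite mxE mulrCA. Qed.

Let dot_delta u i : dot u (delta_mx i 0) = u i 0.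
Proof.
rewrite /dot (bigD1 i)//= big1 ?addr0 ?mxE ?eqxx ?mulr1// => j ji.
by rewrite mxE (negbTE ji) mulr0.
Qed.

Let scale_optimal a c (b : int) x : 0 < b ->
  LP_optimal c a b x -> LP_optimal c a 1 ((b%:~R : R)^-1 *: x).
Proof.
move=> b0 [[x0 ax] xmin].
have bR : 0 < b%:~R :> R by rewrite ltr0z.
split; first split.
- by move=> i; rewrite mxE mulr_ge0// invr_ge0 ltW.
- by rewrite dotZ ax mulVf// gt_eqF.
- move=> y [y0 ay]; rewrite dotZ mulrC ler_pdivrMr// mulrC -dotZ.
  apply: xmin; split; last by rewrite dotZ ay mulr1.
  by move=> i; rewrite mxE mulr_ge0// ltW.
Qed.

Lemma generic_tau a c : positive_vec a -> generic R a c ->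
  exists! t : 'I_n, is_tau R a c t.
Proof.
move=> apos gen; have [x [[[x0 ax] xmin] xuniq]] := gen 1 ltr01.
have aR i : 0 < intvec R a i 0 by rewrite mxE ltr0z.
have [t xt] : exists t, x t 0 != 0.
  apply: contrapT => /forallNP nx; move: ax; rewrite /dot big1 => [/eqP|i _].
    by rewrite eq_sym oner_eq0.
  by have /negP := nx i; rewrite negbK => /eqP ->; rewrite mulr0.
have single i : x i 0 != 0 -> i = t.
  move=> xi; apply: contrapT => /eqP it.
  have xi0 : 0 < x i 0 by rewrite lt0r xi x0.
  have xt0 : 0 < x t 0 by rewrite lt0r xt x0.
  pose v : 'cV[R]_n := (intvec R a i 0)^-1 *: delta_mx i 0
                     + (- (intvec R a t 0)^-1) *: delta_mx t 0.
  have av : dot (intvec R a) v = 0.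
    by rewrite dotD !dotZ !dot_delta mulNr !mulVf ?subrr// gt_eqF.
  have vi : v i 0 = (intvec R a i 0)^-1.
    by rewrite !mxE !eqxx (negbTE it)/= mulr1 mulr0 addr0.
  have vt : v t 0 = - (intvec R a t 0)^-1.
    by rewrite !mxE !eqxx eq_sym (negbTE it)/= mulr1 mulr0 add0r.
  have vj j : j != i -> j != t -> v j 0 = 0.
    by move=> ji jt; rewrite !mxE (negbTE ji) (negbTE jt)/= !mulr0 addr0.
  clearbody v.
  pose e := Num.min (x i 0 * intvec R a i 0) (x t 0 * intvec R a t 0).
  have e0 : 0 < e by rewrite lt_min !mulr_gt0.
  have feas s : `|s| <= e -> knapsack R a 1 (x + s *: v).
    move=> se; split; last by rewrite dotD dotZ av mulr0 addr0 ax.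
    move: se; rewrite le_min => /andP[].
    rewrite -!ler_pdivrMr// => si st.
    move=> j; rewrite [(x + _) j 0]mxE [(s *: v) j 0]mxE.
    have [->|ji] := eqVneq j i.
      rewrite vi -lerBlDr sub0r; apply: le_trans si.
      by rewrite -mulNr ler_pM2r ?invr_gt0// -normrN ler_norm.
    have [->|jt] := eqVneq j t.
      rewrite vt mulrN subr_ge0; apply: le_trans st.
      by rewrite ler_pM2r ?invr_gt0// ler_norm.
    by rewrite vj// mulr0 addr0.
  have cv0 : dot (ratvec R c) v = 0.
    have ee : `|e| <= e by rewrite gtr0_norm.
    have ne : `|- e| <= e by rewrite normrN.
    have := xmin _ (feas _ ee); have := xmin _ (feas _ ne).
    rewrite !dotD !dotZ !lerDl mulNr oppr_ge0 => h1 h2.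
    have : e * dot (ratvec R c) v = 0 by apply/eqP; rewrite eq_le h1 h2.
    by move/eqP; rewrite mulf_eq0 (gt_eqF e0) => /eqP.
  have : x = x + e *: v.
    apply: xuniq; split; first by apply: feas; rewrite gtr0_norm.
    by move=> y /xmin; rewrite dotD dotZ cv0 mulr0 addr0.
  move=> /(congr1 (fun z : 'cV[R]_n => z i 0)).
  rewrite [(x + _) i 0]mxE [(e *: v) i 0]mxE vi => /eqP.
  rewrite -subr_eq0 opprD addrA subrr add0r oppr_eq0 mulf_eq0 invr_eq0.
  by rewrite !gt_eqF.
have taut : is_tau R a c t.
  move=> b b0 y /(scale_optimal b0)/xuniq xE i.
  have -> : (y i 0 != 0) = (x i 0 != 0).
    by rewrite xE mxE mulf_eq0 invr_eq0 intr_eq0 (gt_eqF b0).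
  by apply/idP/eqP => [/single//|->].
exists t; split=> // s taus.
have xopt : LP_optimal c a 1 x by [].
by apply/eqP; rewrite -(taus 1 ltr01 x xopt).
Qed.

End GenericTau.

(* Main.v *)
(* Write m = a_tau, a' = pi_tau(a) and let L be the lattice of integer z with
   m | a'z.  On the knapsack polytope c^T x - LP = l^T x', so the gap measures
   how far into the positive orthant one must go, in the weight l, to meet a
   class of Z^(n-1)/L.  Rescaling by diag(l) turns this weight into that of the
   standard simplex: the gap is at least mu(S, diag(l) L) - ||l||_1, and
   det(diag(l) L) = m l_1...l_(n-1), which gives (i).  For (ii), take
   c = (0, a'), so l = a'.  Up to scaling, a nearly optimal lattice is close to
   an integer lattice A Z^(n-1) with cyclic quotient, i.e. {z : m | al z} with
   m = |det A| and al primitive.  Replacing al by al + M m (1,...,1) does not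
   change that lattice and makes diag(a') almost scalar for large M. *)
Require Import Defs.
From HB Require Import structures.
From mathcomp Require Import all_boot all_order all_algebra.
From mathcomp Require Import all_classical all_reals all_analysis.
From mathcomp Require Import zify ring lra.

Set Implicit Arguments.
Unset Strict Implicit.
Unset Printing Implicit Defensive.

Import Order.TTheory GRing.Theory Num.Theory.
Local Open Scope classical_set_scope.
Local Open Scope ring_scope.

Lemma intvecB (R : realType) n (u v : 'cV[int]_n) :
  intvec R (u - v) = intvec R u - intvec R v.
Proof. exact: map_mxB. Qed.

Lemma intvecM (R : realType) m n (A : 'M[int]_(m, n)) (w : 'cV[int]_n) :
  intvec R (A *m w) = map_mx intr A *m intvec R w.
Proof. exact: map_mxM. Qed.

Lemma intvec_floor (R : realType) n (x : 'cV[R]_n) :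
  exists z : 'cV[int]_n,
    forall i, 0 <= (x - intvec R z) i 0 /\ (x - intvec R z) i 0 < 1.
Proof.
exists (\col_i Num.floor (x i 0)) => i; rewrite !mxE.
by have /andP[h1 h2] := floor_itv (x i 0); split; [rewrite subr_ge0|rewrite ltrBlDr addrC -intrD1].
Qed.

(** * Coverings of space by dilated simplices, and the covering constant *)

Section Covering.
Context (R : realType).

(** Lattice points are given by integer coordinates [w], so that translates can be manipulated
    directly. [coversP] links this, for [th > 0], to the Minkowski sums in [covering_radius]. *)
Definition covers d (th : R) (B : 'M[R]_d) : Prop :=
  forall y : 'cV[R]_d, exists w : 'cV[int]_d,
    (forall i, 0 <= (y - B *m intvec R w) i 0) /\
    \sum_i (y - B *m intvec R w) i 0 <= th.

Definition lattice_of d (B : 'M[R]_d) : set 'cV[R]_d :=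
  [set B *m z | z in Zn R d].

Lemma coversP d (th : R) (B : 'M[R]_d) : 0 < th ->
  covers th B <->
  [set th *: k + y | k in simplex R d & y in lattice_of B] = setT.
Proof.
move=> th0; split=> [cov|covT y].
  rewrite predeqE => y; split=> // _; have [w [w0 wth]] := cov y.
  exists (th^-1 *: (y - B *m intvec R w)).
    split=> [i|]; first by rewrite mxE mulr_ge0// invr_ge0 ltW.
    under eq_bigr do rewrite mxE.
    by rewrite -mulr_sumr ler_pdivrMl// mulr1.
  exists (B *m intvec R w); first by exists (intvec R w) => //; exists w.
  by rewrite scalerA divff ?gt_eqF// scale1r subrK.
have : [set: 'cV[R]_d] y by [].
rewrite -covT => -[k [k0 k1] [_ [_ [w _ <-] <-] <-]].
exists w; rewrite addrK; split=> [i|]; first by rewrite mxE mulr_ge0// ltW.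
under eq_bigr do rewrite mxE.
by rewrite -mulr_sumr -[leRHS]mulr1 ler_pM2l.
Qed.

Lemma coversW d (th th' : R) (B : 'M[R]_d) :
  th <= th' -> covers th B -> covers th' B.
Proof.
by move=> le cov y; have [w [w0 wth]] := cov y; exists w; split=> //; apply: le_trans le.
Qed.

Lemma covers_ge0 d (th : R) (B : 'M[R]_d) : covers th B -> 0 <= th.
Proof. by move=> /(_ 0)[w [w0]]; apply: le_trans; apply: sumr_ge0. Qed.

Lemma coversZ d (s th : R) (B : 'M[R]_d) :
  0 < s -> covers th B -> covers (s * th) (s *: B).
Proof.
move=> s0 cov y; have [w [w0 wth]] := cov (s^-1 *: y); exists w.
have -> : y - (s *: B) *m intvec R w = s *: (s^-1 *: y - B *m intvec R w).
  by rewrite scalerBr scalerA divff ?gt_eqF// scale1r scalemxAl.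
split=> [i|]; first by rewrite mxE mulr_ge0// ltW.
under eq_bigr do rewrite mxE.
by rewrite -mulr_sumr ler_pM2l.
Qed.

Lemma mx_bounded m n (A : 'M[R]_(m, n)) :
  exists2 C : R, 0 < C & forall i j, `|A i j| <= C.
Proof.
exists (1 + \sum_i \sum_j `|A i j|) => [|i j].
  by rewrite ltr_pwDl// sumr_ge0// => i _; rewrite sumr_ge0.
rewrite ler_wpDl// (bigD1 i)//= ler_wpDr//.
  by rewrite sumr_ge0// => k _; rewrite sumr_ge0.
by rewrite (bigD1 j)//= ler_wpDr// sumr_ge0.
Qed.

Lemma ler_norm_mulmx m n p (A : 'M[R]_(m, n)) (X : 'M[R]_(n, p)) a b :
  (forall i j, `|A i j| <= a) -> (forall i j, `|X i j| <= b) ->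
  forall i j, `|(A *m X) i j| <= n%:R * (a * b).
Proof.
move=> Aa Xb i j; rewrite mxE (le_trans (ler_norm_sum _ _ _))//.
rewrite mulr_natl -[n in _ *+ n]card_ord -sumr_const ler_sum// => k _.
by rewrite normrM ler_pM.
Qed.

(** Rounding down in the basis [B] leaves an error [B *m f] with entries in [-e, e]; shifting [y]
    down by [e] beforehand puts every coordinate of the remainder in [0, 2e]. *)
Lemma covers_exists d (B : 'M[R]_d) : B \in unitmx ->
  exists2 th, 0 < th & covers th B.
Proof.
move=> Bu; have [C C0 BC] := mx_bounded B; pose e := d%:R * (C * 1).
have e0 : 0 <= e by rewrite !mulr_ge0// ltW.
exists (1 + d%:R * (2 * e)) => [|y].
  by rewrite ltr_pwDl// mulr_ge0// mulr_ge0.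
have [w wP] := intvec_floor (invmx B *m (y - const_mx e)); exists w.
set f := _ - _ in wP.
have -> : y - B *m intvec R w = const_mx e + B *m f.
  by rewrite mulmxBr mulKVmx// addrA addrCA subrr addr0.
have f1 i j : `|f i j| <= 1.
  by have [h1 h2] := wP i; rewrite ord1 ger0_norm// ltW.
have Bf i : `|(B *m f) i 0| <= e by apply: ler_norm_mulmx.
split=> [i|].
  have := Bf i; rewrite ler_norml => /andP[+ _].
  by move: (B *m f) => g; rewrite !mxE; lra.
apply: le_trans (_ : \sum_(i < d) 2 * e <= _); last first.
  by rewrite sumr_const card_ord (mulr_natl (2 * e)) ler_wpDl.
apply: ler_sum => i _; rewrite [leLHS]mxE mxE mulr_natl mulr2n lerD2l.
exact: le_trans (ler_norm _) (Bf i).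
Qed.

Lemma unitmx_det d (B : 'M[R]_d) : (B \in unitmx) = (\det B != 0).
Proof. by rewrite unitmxE unitfE. Qed.

(** [inf] takes a default value on sets that are empty or unbounded below; this lemma and
    [has_inf_rho] exclude that for the two nested infima. *)
Lemma has_inf_covering d (B : 'M[R]_d) : B \in unitmx ->
  has_inf [set m | 0 < m /\
    [set m *: k + y | k in simplex R d & y in lattice_of B] = setT].
Proof.
move=> /covers_exists[th th0 cov]; split; last by exists 0 => m [/ltW].
by exists th; split=> //; apply/coversP.
Qed.

Lemma covering_radius_ge0 d (B : 'M[R]_d) : B \in unitmx ->
  0 <= covering_radius (simplex R d) (lattice_of B).
Proof. by move=> /has_inf_covering[ne _]; apply: lb_le_inf => // m [/ltW]. Qed.

Lemma has_inf_rho d :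
  has_inf [set covering_radius (simplex R d) L | L in lattice_with_det 1].
Proof.
split.
  exists (covering_radius (simplex R d) (lattice_of 1%:M)).
  by exists (lattice_of 1%:M) => //; exists 1%:M; rewrite unitmx1 det1 normr1.
by exists 0 => _ [_ [B [Bu -> _]] <-]; apply: covering_radius_ge0.
Qed.

Lemma rho_le d th (B : 'M[R]_d) : `|\det B| = 1 -> 0 < th -> covers th B ->
  rho R d <= th.
Proof.
move=> B1 th0 cov.
have Bu : B \in unitmx by rewrite unitmx_det -normr_eq0 B1 oner_eq0.
apply: le_trans (_ : covering_radius (simplex R d) (lattice_of B) <= _).
  apply: ge_inf; first by have [] := has_inf_rho d.
  by exists (lattice_of B) => //; exists B.
apply: ge_inf; first by have [] := has_inf_covering Bu.
by split=> //; apply/coversP.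
Qed.

(** First a near-optimal lattice, then a near-optimal dilation for it; the strict bound avoids
    proving that either infimum is attained. *)
Lemma rho_adherent d r : rho R d < r ->
  exists (B : 'M[R]_d) (th : R),
    [/\ `|\det B| = 1, 0 < th, th < r & covers th B].
Proof.
rewrite -subr_gt0 => /inf_adherent/(_ (has_inf_rho d)).
rewrite -/(rho R d) addrC subrK => -[_ [_ [B [Bu -> B1]] <-]].
rewrite -subr_gt0 => /inf_adherent/(_ (has_inf_covering Bu))[th].
rewrite -/(covering_radius _ _) addrC subrK => -[th0 cov] thr.
by exists B, th; split=> //; apply/coversP.
Qed.

(** Dividing [B] by the d-th root of its absolute determinant normalizes the lattice, and coverings
    scale linearly. *)
Lemma rho_powR_le d th (B : 'M[R]_d) : (0 < d)%N -> \det B != 0 -> 0 < th ->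
  covers th B -> rho R d * `|\det B| `^ d%:R^-1 <= th.
Proof.
move=> d0 B0 th0 cov; set s := _ `^ _.
have s0 : 0 < s by rewrite powR_gt0 ?normr_gt0.
have sd : s ^+ d = `|\det B|.
  by rewrite -powR_mulrn ?ltW// -powRrM mulVf ?powRr1// pnatr_eq0 -lt0n.
rewrite -ler_pdivlMr// mulrC; apply: (@rho_le _ _ (s^-1 *: B)).
- by rewrite detZ exprVn sd normrM normfV normr_id mulVf ?normr_eq0.
- by rewrite mulr_gt0// invr_gt0.
- by apply: coversZ => //; rewrite invr_gt0.
Qed.

(* [F = B' B^-1 - 1] moves the simplex inside a translate of a slightly larger
   one, and covering the whole space does not see translations. *)
Lemma covers_perturb d th f (B B' : 'M[R]_d) :
  B \in unitmx -> B' \in unitmx -> 0 <= th -> 0 <= f ->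
  (forall i j, `|(B' *m invmx B - 1%:M) i j| <= f) ->
  covers th B -> covers (th * (1 + 2 * f * d%:R)) B'.
Proof.
move=> Bu B'u th0 f0 Ff cov y; set F := B' *m invmx B - 1%:M in Ff.
(* The entries of [F *m x] are at least [- (f * th)]; subtracting [f * th] from [y] beforehand keeps
   the final remainder nonnegative, at a cost of at most [2 * f * th] per coordinate. *)
pose y' := B *m invmx B' *m (y - const_mx (f * th)).
have [w [x0 xth]] := cov y'; exists w; set x := _ - _ in x0 xth.
have -> : y - B' *m intvec R w = x + F *m x + const_mx (f * th).
  have -> : x + F *m x = B' *m (invmx B *m x).
    by rewrite mulmxBl mul1mx addrC subrK mulmxA.
  rewrite mulmxBr mulKmx// mulmxBr /y' !mulmxA mulmxKV// mulmxV// mul1mx.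
  by rewrite addrAC subrK.
have xle i : `|(F *m x) i 0| <= f * th.
  rewrite mxE (le_trans (ler_norm_sum _ _ _))//.
  apply: le_trans (_ : \sum_j f * x j 0 <= _).
    by apply: ler_sum => j _; rewrite normrM (ger0_norm (x0 j)) ler_wpM2r.
  by rewrite -mulr_sumr ler_wpM2l.
split=> [i|].
  have := xle i; rewrite ler_norml => /andP[+ _]; move: (x0 i).
  by move: (F *m x) => g; rewrite !mxE; lra.
apply: le_trans (_ : \sum_i (x i 0 + 2 * (f * th)) <= _).
  apply: ler_sum => i _; have := le_trans (ler_norm _) (xle i).
  by move: (F *m x) => g gle; rewrite !mxE; lra.
rewrite big_split/= sumr_const card_ord -(mulr_natr (2 * _)).
by rewrite (_ : th * _ = th + 2 * (f * th) * d%:R) ?lerD//; ring.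
Qed.
End Covering.

(** * Deleting a coordinate, and reduced costs of the knapsack program *)

Lemma dot_lift (K : comPzRingType) n (t : 'I_n) (u v : 'cV[K]_n) :
  dot u v = u t 0 * v t 0 + dot (row' t u) (row' t v).
Proof.
by rewrite /dot (bigD1_ord t)//=; congr (_ + _); apply: eq_bigr => i _; rewrite !mxE.
Qed.

Lemma dotBr (K : comPzRingType) n (u v w : 'cV[K]_n) :
  dot u (v - w) = dot u v - dot u w.
Proof. by rewrite /dot -sumrB; apply: eq_bigr => i _; rewrite !mxE mulrBr. Qed.

Lemma dotDr (K : comPzRingType) n (u v w : 'cV[K]_n) :
  dot u (v + w) = dot u v + dot u w.
Proof. by rewrite /dot -big_split; apply: eq_bigr => i _; rewrite !mxE mulrDr. Qed.

Lemma dot_const_mx (K : comPzRingType) n (u : 'cV[K]_n) k :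
  dot u (const_mx k) = (\sum_i u i 0) * k.
Proof. by rewrite mulr_suml; apply: eq_bigr => i _; rewrite mxE. Qed.

Lemma dot_intvec (R : realType) n (u v : 'cV[int]_n) :
  dot (intvec R u) (intvec R v) = (dot u v)%:~R.
Proof. by rewrite /dot rmorph_sum; apply: eq_bigr => i _; rewrite !mxE rmorphM. Qed.

Definition insert (K : Type) n (t : 'I_n) (x0 : K) (x : 'cV[K]_n.-1) : 'cV[K]_n :=
  \col_i oapp (fun j => x j 0) x0 (unlift t i).

Lemma insert_eq (K : Type) n (t : 'I_n) (x0 : K) x : insert t x0 x t 0 = x0.
Proof. by rewrite mxE unlift_none. Qed.

Lemma row'_insert (K : Type) n (t : 'I_n) (x0 : K) x : row' t (insert t x0 x) = x.
Proof. by apply/colP => i; rewrite !mxE liftK. Qed.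

Lemma forall_lift n (t : 'I_n) (P : 'I_n -> Prop) :
  P t -> (forall j, P (lift t j)) -> forall i, P i.
Proof. by move=> Pt Pl i; case: (unliftP t i) => [j ->|->]. Qed.

Section ReducedCost.
Context (R : realType) n (a : 'cV[int]_n) (c : 'cV[rat]_n) (t : 'I_n).
Hypothesis apos : positive_vec a.
Let l : 'cV[R]_n.-1 := ratvec R (lvec a c t).
Let k : R := ratr (c t 0) / (a t 0)%:~R.

Let at_neq0 : (a t 0)%:~R != 0 :> R.
Proof. by rewrite intr_eq0 gt_eqF// apos. Qed.

(** Solve the constraint for the coordinate [t] and substitute: [k] is the dual price of the
    constraint and [l] the vector of reduced costs. *)
Lemma dot_reduced_cost (b : R) (x : 'cV[R]_n) : dot (intvec R a) x = b ->
  dot (ratvec R c) x = k * b + dot l (row' t x).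
Proof.
move=> <-; rewrite !(dot_lift t) mulrDr addrAC.
rewrite [intvec R a t 0]mxE [ratvec R c t 0]mxE -addrA [RHS]addrC -addrA addrA [LHS]addrC.
congr (_ + _); last by rewrite /k mulrA divfK.
rewrite /dot mulr_sumr -big_split/=; apply: eq_bigr => i _; rewrite !mxE.
rewrite rmorphB rmorphM fmorph_div /= !ratr_int -/k; ring.
Qed.

Hypothesis l0 : forall i, 0 <= l i 0.

Lemma dot_reduced_cost_ge0 (x : 'cV[R]_n) : (forall i, 0 <= x i 0) ->
  0 <= dot l (row' t x).
Proof. by move=> x0; apply: sumr_ge0 => i _; rewrite mulr_ge0// mxE. Qed.

(** The vertex supported on [t] attains the bound given by nonnegative reduced costs. The case
    [b = 0] is included because [Gap] ranges over it, whereas genericity concerns positive [b]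
    only. *)
Lemma LPE (b : int) : 0 <= b -> LP R c a b = (k * b%:~R)%:E.
Proof.
move=> b0; apply/eqP; rewrite eq_le; apply/andP; split.
  pose x := insert t (b%:~R / (a t 0)%:~R : R) 0.
  have ax : dot (intvec R a) x = b%:~R.
    rewrite (dot_lift t) insert_eq row'_insert mxE [X in _ + X]big1 => [|i _]; last first.
      by rewrite [X in _ * X]mxE mulr0.
    by rewrite addr0 mulrC divfK.
  apply: ereal_inf_lbound; exists (k * b%:~R) => //; exists x.
    split=> //; apply: (forall_lift (t := t)) => [|j].
      by rewrite insert_eq divr_ge0// ler0z// ltW// apos.
    by have /colP/(_ j) := row'_insert t (b%:~R / (a t 0)%:~R : R) 0; rewrite !mxE => ->.
  rewrite (dot_reduced_cost ax) row'_insert [X in _ + X]big1 ?addr0// => i _.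
  by rewrite [X in _ * X]mxE mulr0.
apply: le_ereal_inf_tmp => _ [_ [x [x0 ax] <-] <-].
by rewrite lee_fin (dot_reduced_cost ax) lerDl dot_reduced_cost_ge0.
Qed.

Lemma IP_valuesP (b : int) v : IP_values R c a b v <->
  exists x : 'cV[int]_n, [/\ forall i, 0 <= x i 0, dot a x = b &
    v = k * b%:~R + dot l (intvec R (row' t x))].
Proof.
have row'E (z : 'cV[int]_n) : row' t (intvec R z) = intvec R (row' t z).
  by rewrite /intvec map_row'.
split=> [[y [[y0 ay] [x _ xE]] <-]|[x [x0 ax ->]]].
  move: y0 ay; rewrite -xE => x0 ax; exists x; split=> [i||].
  - by have := x0 i; rewrite mxE ler0z.
  - by apply/eqP; rewrite -(eqr_int R) -dot_intvec ax.
  - by rewrite (dot_reduced_cost ax) row'E.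
have ax' : dot (intvec R a) (intvec R x) = b%:~R by rewrite dot_intvec ax.
exists (intvec R x); last by rewrite (dot_reduced_cost ax') row'E.
by split; [split=> // i; rewrite mxE ler0z|exists x].
Qed.

Lemma has_inf_IP_values (x : 'cV[int]_n) : (forall i, 0 <= x i 0) ->
  has_inf (IP_values R c a (dot a x)).
Proof.
move=> x0; split.
  by exists (k * (dot a x)%:~R + dot l (intvec R (row' t x))); apply/IP_valuesP; exists x.
exists (k * (dot a x)%:~R) => _ [y [[y0 ay] _] <-].
by rewrite (dot_reduced_cost ay) lerDl dot_reduced_cost_ge0.
Qed.

Lemma dot_ge0 (x : 'cV[int]_n) : (forall i, 0 <= x i 0) -> 0 <= dot a x.
Proof. by move=> x0; apply: sumr_ge0 => i _; rewrite mulr_ge0// ltW. Qed.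

(** The term [k * b] cancels between the two programs, so only [l] evaluated on [row' t x] remains.
    [IG_lt] conversely extracts an integer point from a bound on the gap. *)
Lemma IG_le (x : 'cV[int]_n) : (forall i, 0 <= x i 0) ->
  (IG R c a (dot a x) <= (dot l (intvec R (row' t x)))%:E)%E.
Proof.
move=> x0; rewrite /IG LPE ?dot_ge0// leeBlDr// -EFinD; apply: ereal_inf_lbound.
exists (k * (dot a x)%:~R + dot l (intvec R (row' t x))); last by rewrite addrC.
by apply/IP_valuesP; exists x.
Qed.

Lemma IG_lt (b : int) y : 0 <= b -> (IG R c a b < y%:E)%E ->
  exists x : 'cV[int]_n, [/\ forall i, 0 <= x i 0, dot a x = b &
    dot l (intvec R (row' t x)) < y].
Proof.
move=> b0; rewrite /IG LPE// lteBlDr// -EFinD => /ereal_inf_lt[_ [v /IP_valuesP + <-]].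
move=> [x [x0 ax ->]]; rewrite lte_fin addrC ltrD2r => lx.
by exists x.
Qed.

End ReducedCost.

(** For [b = 1], compare the unique optimum, supported on [t], with the vertex on another axis:
    their costs differ by [l_i / a_i]. Optimality makes this nonnegative, and zero would give a
    second optimum. *)
Lemma lvec_gt0 (R : realType) n (a : 'cV[int]_n) (c : 'cV[rat]_n) (t : 'I_n) :
  positive_vec a -> generic R a c -> is_tau R a c t ->
  forall i, 0 < lvec a c t i 0.
Proof.
move=> apos gen taut i; have [x [[[x0 ax] xmin] xuniq]] := gen 1 ltr01.
have xt j : x (lift t j) 0 = 0.
  apply/eqP; rewrite -[_ == 0]negbK (taut 1 ltr01 x)//.
  by rewrite eq_sym (negbTE (neq_lift _ _)).
pose l := ratvec R (lvec a c t).
have cx := dot_reduced_cost c t apos ax.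
rewrite [X in _ + X]big1 ?addr0 in cx => [|j _]; last by rewrite [X in _ * X]mxE xt mulr0.
have ai0 : (a (lift t i) 0)%:~R != 0 :> R by rewrite intr_eq0 gt_eqF.
pose y := (a (lift t i) 0)%:~R^-1 *: delta_mx (lift t i) 0 : 'cV[R]_n.
have yfeas : knapsack R a 1 y.
  split=> [j|]; first by rewrite !mxE mulr_ge0// invr_ge0 ler0z ltW.
  rewrite /dot (bigD1 (lift t i))//= big1 ?addr0 => [|j ji].
    by rewrite !mxE !eqxx mulr1 mulfV.
  by rewrite !mxE (negbTE ji)/= !mulr0.
have cy := dot_reduced_cost c t apos yfeas.2.
have ly : dot l (row' t y) = l i 0 / (a (lift t i) 0)%:~R.
  rewrite /dot (bigD1 i)//= big1 ?addr0 => [|j ji].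
    by move: (l i 0) => li; rewrite !mxE !eqxx mulr1.
  by move: (l j 0) => lj; rewrite !mxE (inj_eq lift_inj) (negbTE ji) !mulr0.
have : 0 < l i 0 / (a (lift t i) 0)%:~R; last first.
  by rewrite pmulr_lgt0 ?invr_gt0 ?ltr0z// mxE ltr0q.
rewrite lt_neqAle; apply/andP; split; last first.
  by have := xmin _ yfeas; rewrite cx cy -/l ly lerDl.
apply/eqP => ly0.
have : x = y.
  by apply: xuniq; split=> // z /xmin; rewrite cx cy -/l ly -ly0 addr0.
move=> /colP/(_ (lift t i)); rewrite xt !mxE !eqxx mulr1 => /esym/eqP.
by rewrite invr_eq0 (negbTE ai0).
Qed.

(** * Congruence lattices and the lower bound (i) *)

Lemma unitmx_int_normr_det d (A : 'M[int]_d) : A \in unitmx -> `|\det A| = 1.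
Proof. by rewrite unitmxE => /orP[]/eqP->. Qed.

(** By the Smith form, [a] is an integer multiple of the first row of a unimodular [P], and that
    multiple is coprime to [m]. The congruence thus says that [m] divides the first coordinate of
    [P *m z], which is the lattice of diag(m, 1, ..., 1) in the coordinates [P]. *)
Lemma congruence_lattice_basis d (a : 'cV[int]_d.+1) (m : int) : 0 < m ->
  (forall g : nat, (g %| `|m|)%N -> (forall i, (g %| `|a i 0%R|)%N) -> g = 1%N) ->
  exists2 Q : 'M[int]_d.+1, `|\det Q| = m &
    forall z, (m %| dot a z)%Z -> exists w, z = Q *m w.
Proof.
move=> m0 cop; have [L Lu [P Pu [s _ aE]]] := int_Smith_normal_form a^T.
have aiE i : a i 0 = L 0 0 * s`_0 * P 0 i.
  have /matrixP/(_ 0 i) := aE; rewrite mxE => ->.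
  rewrite mxE (bigD1 ord0)//= big1 ?addr0 => [|j j0]; last first.
    rewrite mxE big_ord1 mxE eq_sym (_ : _ == _ = false) ?mulr0n ?mulr0 ?mul0r//.
    exact/negbTE.
  by rewrite mxE big_ord1 mxE mulr1n.
have dotE z : dot a z = L 0 0 * s`_0 * (P *m z) 0 0.
  by rewrite /dot mxE mulr_sumr; apply: eq_bigr => i _; rewrite aiE mulrA.
have cop0 : coprimez m (L 0 0 * s`_0).
  apply/eqP; rewrite /gcdz; congr Posz; apply: cop => [|i].
    exact: dvdn_gcdl.
  by rewrite aiE (abszM (_ * _)) dvdn_mulr// dvdn_gcdr.
pose delta := \row_(j < d.+1) (if j == 0 then m else 1).
exists (invmx P *m diag_mx delta).
  have detP : `|\det (invmx P)| = 1.
    by apply: unitmx_int_normr_det; rewrite unitmx_inv.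
  rewrite det_mulmx det_diag normrM detP mul1r (bigD1 ord0)//= big1 => [|i i0].
    by rewrite mxE eqxx mulr1 gtr0_norm.
  by rewrite mxE (negbTE i0).
move=> z; rewrite dotE Gauss_dvdzr// => /dvdzP[q qE].
exists (\col_i (if i == 0 then q else (P *m z) i 0)).
rewrite -mulmxA; apply: (canRL (mulKmx Pu)); apply/colP => i.
rewrite mul_diag_mx !mxE; case: eqP => [->|_]; last by rewrite mul1r.
by rewrite mulrC -qE mxE.
Qed.

(** Round [y / l] down to [z] and solve the integer program whose right-hand side has the class of
    [z]. The solution [x] makes [z - row' t x] a lattice point, and the remainder is [l] times
    (fractional part + [row' t x]): nonnegative, with the first part summing to at most the norm of
    [l] and the second to less than [g + e]. *)
Lemma gap_covers (R : realType) d (a : 'cV[int]_d.+2) (c : 'cV[rat]_d.+2)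
    (t : 'I_d.+2) (Q : 'M[int]_d.+1) (g e : R) :
  positive_vec a -> (forall i, 0 < lvec a c t i 0) -> 0 < e ->
  (forall z, (a t 0%R %| dot (row' t a) z)%Z -> exists w, z = Q *m w) ->
  (Gap R c a <= g%:E)%E ->
  covers (g + ratr (norm1 (lvec a c t)) + e)
    (diag_mx (ratvec R (lvec a c t))^T *m map_mx intr Q).
Proof.
move=> apos l_gt0 e0 QP gapg y; set lq := lvec a c t in l_gt0 *.
set l := ratvec R lq.
have l0 i : 0 < l i 0 by rewrite mxE ltr0q.
pose u : 'cV[R]_d.+1 := \col_i (y i 0 / l i 0).
have [z zP] := intvec_floor u.
pose K := \sum_i `|z i 0|.
have K0 : 0 <= K by apply: sumr_ge0.
(* Adding a multiple of [m] makes [z] nonnegative without changing its class modulo [m]. *)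
pose m := a t 0; pose z' := z + const_mx (m * K).
have z'0 i : 0 <= z' i 0.
  have zK : - K <= z i 0.
    rewrite lerNl; apply: le_trans (_ : `|z i 0| <= _).
      by rewrite -normrN ler_norm.
    by rewrite /K (bigD1 i)//= lerDl sumr_ge0.
  rewrite !mxE -lerBlDr sub0r; apply: le_trans zK.
  by rewrite lerN2 ler_peMl// -gtz0_ge1 apos.
have x00 : forall i, 0 <= insert t 0 z' i 0.
  apply: (forall_lift (t := t)) => [|j]; first by rewrite insert_eq.
  by have /colP/(_ j) := row'_insert t 0 z'; rewrite mxE => ->.
have lw i : 0 <= ratvec R lq i 0 by exact: ltW.
have IGg : (IG R c a (dot a (insert t 0%Z z')) < (g + e)%:E)%E.
  apply: le_lt_trans (_ : (g%:E < _)%E); last by rewrite lte_fin ltrDl.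
  apply: le_trans gapg; apply: ereal_sup_ubound.
  exists (dot a (insert t 0 z')) => //.
  exact: (has_inf_IP_values apos lw).
have [x [x0 ax lx]] := IG_lt apos lw (dot_ge0 apos x00) IGg.
have [w wE] : exists w, z - row' t x = Q *m w.
  apply: QP; rewrite dotBr.
  move: ax; rewrite !(dot_lift t) insert_eq row'_insert mulr0 add0r.
  rewrite dotDr dot_const_mx -/m => ax.
  apply/dvdzP; exists (x t 0 - (\sum_i row' t a i 0) * K).
  apply/eqP; rewrite subr_eq; apply/eqP.
  by have -> : dot (row' t a) z = m * x t 0 + dot (row' t a) (row' t x)
    - (\sum_i row' t a i 0) * (m * K); [rewrite ax; ring|ring].
exists w; rewrite -mulmxA -intvecM -wE intvecB.
have yE i : (y - diag_mx l^T *m (intvec R z - intvec R (row' t x))) i 0 =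
    l i 0 * ((u - intvec R z) i 0 + intvec R (row' t x) i 0).
  have : u i 0 = y i 0 / l i 0 by rewrite mxE.
  rewrite mul_diag_mx; move: (intvec R _) (intvec R _) (u) => v1 v2 v3.
  by rewrite [l]lock !mxE -lock => ->; field; rewrite gt_eqF.
have xr0 i : 0 <= intvec R (row' t x) i 0 by rewrite !mxE ler0z.
split=> [i|].
  by rewrite yE mulr_ge0 ?addr_ge0//; have [] := zP i.
under eq_bigr do rewrite yE mulrDr.
rewrite big_split/= -/(dot l (intvec R (row' t x))).
have : \sum_i l i 0 * (u - intvec R z) i 0 <= ratr (norm1 lq).
  rewrite /norm1 rmorph_sum; apply: ler_sum => i _ /=.
  rewrite gtr0_norm// [X in X * _]mxE -[leRHS]mulr1 ler_wpM2l ?ler0q ?ltW//.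
  by have [] := zP i.
by move: lx; rewrite -/l; lra.
Qed.

Lemma gap_ge (R : realType) d (a : 'cV[int]_d.+2) (c : 'cV[rat]_d.+2)
    (t : 'I_d.+2) : positive_vec a -> gcd_vec a = 1%N ->
  (forall i, 0 < lvec a c t i 0) ->
  ((rho R d.+1
      * ratr ((a t 0)%:~R * \prod_i lvec a c t i 0) `^ d.+1%:R^-1
    - ratr (norm1 (lvec a c t)))%:E <= Gap R c a)%E.
Proof.
move=> apos a1 l0; set r := _ - _; rewrite leNgt; apply/negP => gapr.
(* [Gap] is an extended real; a finite [g] also serves if it were minus infinity. *)
have [g gapg gr] : exists2 g, (Gap R c a <= g%:E)%E & g < r.
  case: (Gap R c a) gapr => [g||]//; first by rewrite lte_fin; exists g.
  by exists (r - 1); rewrite ?leNye// ltrBlDr ltrDl.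
have [|Q detQ QP] := @congruence_lattice_basis _ (row' t a) (a t 0) (apos t).
  move=> k kt ka; apply/eqP; rewrite -dvdn1 -a1; apply/dvdn_biggcdP => i _.
  move: i; apply: (forall_lift (t := t)) => // j.
  by have := ka j; rewrite mxE.
(* One [e] is spent in [gap_covers], a second one makes the dilation factor positive; [2 * e] is
   still below [r - g]. *)
pose e := (r - g) / 3; have e0 : 0 < e by rewrite divr_gt0// subr_gt0.
have cov := gap_covers apos l0 e0 QP gapg.
set B := _ *m _ in cov; set th := _ + _ in cov.
have detB : `|\det B| = ratr ((a t 0)%:~R * \prod_i lvec a c t i 0).
  rewrite det_mulmx det_diag det_map_mx normrM -intr_norm detQ rmorphM /= ratr_int.
  rewrite mulrC; congr (_ * _); rewrite rmorph_prod ger0_norm.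
    by apply: eq_bigr => i _; rewrite !mxE.
  by apply: prodr_ge0 => i _; rewrite mxE mxE ler0q; exact: ltW.
have detB0 : \det B != 0.
  rewrite -normr_eq0 detB fmorph_eq0 mulf_neq0 ?intr_eq0 ?gt_eqF//.
  by apply: prodr_gt0.
have : rho R d.+1 * `|\det B| `^ d.+1%:R^-1 <= th + e.
  apply: rho_powR_le (coversW _ cov) => //; last by rewrite lerDl ltW.
  by rewrite ltr_wpDl// (covers_ge0 cov).
rewrite detB; move: gr; rewrite /th /e /r; lra.
Qed.

(** * Approximation by integer lattices with cyclic quotient *)

(* In Smith coordinates, [N *: A + E] is the bidiagonal matrix with [1] above
   the diagonal; its minor without last row and first column is [1], so the
   quotient of Z^d by its columns is cyclic. *)
Lemma cyclic_perturbation d (A : 'M[int]_d.+1) : exists E : 'M[int]_d.+1,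
  forall N : int, exists al p : 'cV[int]_d.+1, dot al p = 1 /\
    forall w, (\det (N *: A + E) %| dot al ((N *: A + E) *m w)%R)%Z.
Proof.
have [L Lu [P Pu [s _ AE]]] := int_Smith_normal_form A.
pose U := \matrix_(i < d.+1, j < d.+1) ((j == i.+1 :> nat)%:R : int).
exists (L *m U *m P) => N.
pose D := \matrix_(i < d.+1, j < d.+1) (s`_i *+ (i == j :> nat)).
pose C := N *: D + U.
have -> : N *: A + L *m U *m P = L *m C *m P.
  by rewrite AE mulmxDr mulmxDl -scalemxAr -scalemxAl.
have cof : cofactor C ord_max 0 = (-1) ^+ d.
  rewrite /cofactor addn0 -[RHS]mulr1; congr (_ * _).
  rewrite det_trig; last first.
    apply/is_trig_mxP => i j ij; rewrite !mxE lift0 lift_max eqSS.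
    by rewrite [_ == i :> nat]gtn_eqF// ltn_eqF 1?ltnW// mulr0n mulr0.
  apply: big1 => i _; rewrite !mxE lift0 lift_max eqxx ltn_eqF//.
  by rewrite mulr0n mulr0.
(* Since [\adj C *m C] is the scalar matrix [\det C], this row sends the lattice into multiples of
   the determinant. Its last entry before [invmx L] is the cofactor computed above, a sign, which
   [p] picks out. *)
pose al := row 0 (\adj C) *m invmx L.
have dotE (x : 'cV[int]_d.+1) : dot al^T x = (al *m x) 0 0.
  by rewrite mxE; apply: eq_bigr => i _; rewrite mxE.
exists al^T, ((-1) ^+ d *: (L *m delta_mx ord_max 0)); split.
  rewrite dotE -scalemxAr -mulmxA mulKmx// mxE mxE (bigD1 ord_max)//=.
  rewrite big1 => [|i im]; last by rewrite [X in _ * X]mxE (negbTE im) mulr0.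
  by rewrite [delta_mx _ _ _ _]mxE !eqxx mulr1 addr0 !mxE cof -exprD addnn -signr_odd odd_double.
have absP (M : 'M[int]_d.+1) : M \in unitmx -> `|\det M|%N = 1%N.
  by move=> Mu; apply/eqP; rewrite -eqz_nat abszE unitmx_int_normr_det.
move=> w; rewrite dotE -!mulmxA mulKmx// -row_mul (mulmxA (\adj C)) mul_adj_mx.
rewrite mul_scalar_mx mxE mxE !det_mulmx dvdzE !abszM (absP _ Lu) (absP _ Pu).
by rewrite mul1n muln1 dvdn_mulr.
Qed.

Section Approximation.
Context (R : realType).

Import numFieldNormedType.Exports.

Lemma cvg_det (T : Type) (F : set_system T) (FF : Filter F) d
    (X : T -> 'M[R]_d) (B : 'M[R]_d) :
  (forall i j, X x i j @[x --> F] --> B i j) -> \det (X x) @[x --> F] --> \det B.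
Proof.
move=> XB; apply: cvg_big => [|s _]; first exact: add_continuous.
apply: cvgM; first exact: cvg_cst.
by apply: cvg_big => [|i _]; [exact: mul_continuous|exact: XB].
Qed.

Lemma det_continuous d (B : 'M[R]_d) e : 0 < e -> exists2 del : R, 0 < del &
  forall B' : 'M[R]_d, (forall i j, `|B' i j - B i j| <= del) ->
    `|\det B' - \det B| < e.
Proof.
move=> e0.
have cdet : \det X @[X --> B] --> \det B.
  by apply: (@cvg_det _ _ (nbhs_filter B)) => i j; apply: coord_continuous.
have /cvgrPdist_lt/(_ _ e0)/nbhs_ballP[del /= del0 ballP] := cdet.
exists (del / 2) => [|B' B'B]; first exact: divr_gt0.
rewrite distrC; apply: ballP; split=> // i j.
rewrite /ball/= distrC (le_lt_trans (B'B i j))//.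
by rewrite ltr_pdivrMr// ltr_pMr// ltr1n.
Qed.

(** Round [q *: B] to an integer matrix, multiply by [N], add [E] and divide by [N * q]. Rounding
    costs at most [1 / q], and [E], fixed before [N] is chosen, at most [C / N]. *)
Lemma cyclic_approximation d (B : 'M[R]_d.+1) e : 0 < e ->
  exists (A : 'M[int]_d.+1) (T : R) (al p : 'cV[int]_d.+1),
    [/\ 0 < T, forall i j, `|(T^-1 *: map_mx intr A) i j - B i j| <= e,
      dot al p = 1 & forall w, (\det A %| dot al (A *m w)%R)%Z].
Proof.
move=> e0; pose q := (Num.bound (2 / e)).+1.
have q0 : 0 < q%:R :> R by rewrite ltr0n.
have qe : q%:R^-1 <= e / 2.
  rewrite -[e / 2]invrK lef_pV2 ?posrE ?invr_gt0 ?divr_gt0// invf_div.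
  rewrite (le_trans (ltW (archi_boundP _)))// ?ler_nat//.
  by rewrite divr_ge0 ?ltW.
pose A1 := \matrix_(i, j) Num.floor (q%:R * B i j).
have [E EP] := cyclic_perturbation A1.
have [C C0 EC] := mx_bounded (map_mx intr E : 'M[R]_d.+1).
pose N := (Num.bound (2 * C / e)).+1.
have N0 : 0 < N%:R :> R by rewrite ltr0n.
have NC : C / N%:R <= e / 2.
  rewrite ler_pdivrMr// mulrAC ler_pdivlMr// mulrC [leRHS]mulrC -ler_pdivrMr//.
  rewrite (le_trans (ltW (archi_boundP _)))// ?ler_nat//.
  by rewrite divr_ge0 ?mulr_ge0 ?ltW.
have [al [p [alp aldvd]]] := EP N%:Z.
exists (N%:Z *: A1 + E), (N%:R * q%:R), al, p; split=> // [|i j].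
  exact: mulr_gt0.
have Nn0 : N%:R != 0 :> R by rewrite gt_eqF.
have qn0 : q%:R != 0 :> R by rewrite gt_eqF.
have -> : ((N%:R * q%:R)^-1 *: map_mx intr (N%:Z *: A1 + E)) i j - B i j =
    (A1 i j)%:~R / q%:R - B i j + (E i j)%:~R / N%:R / q%:R.
  rewrite [A1]lock !mxE -lock rmorphD rmorphM /= -pmulrn; field.
  by rewrite Nn0 qn0.
rewrite (splitr e) (le_trans (ler_normD _ _))// lerD//.
  apply: le_trans qe; rewrite -[B i j](mulfK qn0) -mulrBl normrM normfV.
  rewrite (gtr0_norm q0) ler_piMl ?invr_ge0 ?ltW//.
  rewrite mxE (mulrC (B i j)) distrC.
  have /andP[h1] := floor_itv (q%:R * B i j).
  by rewrite intrD1 ger0_norm ?subr_ge0// => h2; lra.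
apply: le_trans NC; rewrite normrM normfV (gtr0_norm q0).
rewrite ler_pdivrMr// -[leLHS]mulr1; apply: ler_pM; rewrite ?ler1n//.
rewrite normrM normfV (gtr0_norm N0) ler_pM2r ?invr_gt0//.
by have := EC i j; rewrite mxE.
Qed.

Lemma rho_cyclic d (r : R) : rho R d.+1 < r ->
  exists (A : 'M[int]_d.+1) (th : R) (al p : 'cV[int]_d.+1),
    [/\ \det A != 0, covers th (map_mx intr A) &
      th < r * (`|\det A|%:~R) `^ d.+1%:R^-1] /\
    dot al p = 1 /\ forall w, (\det A %| dot al (A *m w)%R)%Z.
Proof.
move=> /rho_adherent[B [th0 [B1 th00 th0r cov]]].
have Bu : B \in unitmx by rewrite unitmx_det -normr_eq0 B1 oner_eq0.
pose th1 := (th0 + r) / 2.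
have th01 : th0 < th1 by rewrite /th1; lra.
have th1r : th1 < r by rewrite /th1; lra.
clearbody th1.
have r0 : 0 < r by apply: lt_trans th0r.
have th10 : 0 < th1 by apply: lt_trans th01.
(* The solution of [th0 * (1 + 2 * f * d.+1%:R) = th1], the loss in [covers_perturb]. *)
pose f := (th1 / th0 - 1) / (2 * d.+1%:R).
have f0 : 0 < f by rewrite divr_gt0// subr_gt0 ltr_pdivlMr// mul1r.
have th1E : th0 * (1 + 2 * f * d.+1%:R) = th1.
  by rewrite /f; field; rewrite gt_eqF//= gt_eqF// ltr_wpDl.
have [C C0 BC] := mx_bounded (invmx B).
(* A determinant above [k] is exactly what [th1] being less than [r] times its root requires;
   [k < 1] leaves room around [\det B]. *)
pose k := (th1 / r) ^+ d.+1.
have k1 : k < 1.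
  have q1 : th1 / r < 1 by rewrite ltr_pdivrMr// mul1r.
  by apply: exprn_ilt1 => //; rewrite divr_ge0// ltW.
have [|del del0 delP] := @det_continuous _ B (1 - k); first by rewrite subr_gt0.
(* The first bound controls the determinant, the second the entries of [(B' - B) *m invmx B]. *)
pose e := Num.min del (f / (d.+1%:R * C)).
have e0 : 0 < e by rewrite lt_min del0 divr_gt0// mulr_gt0.
have [A [T [al [p [T0 AB alp aldvd]]]]] := cyclic_approximation B e0.
set B' := T^-1 *: _ in AB.
have kB' : k < `|\det B'|.
  have : `|\det B' - \det B| < 1 - k.
    by apply: delP => i j; apply: le_trans (AB i j) _; rewrite ge_min lexx.
  have := ler_distD 0 (\det B) (\det B'); rewrite subr0 sub0r normrN.
  have := lerB_dist (\det B) (\det B'); rewrite distrC B1; lra.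
have k0 : 0 < k by rewrite exprn_gt0// divr_gt0.
have B'u : B' \in unitmx by rewrite unitmx_det -normr_gt0 (lt_trans k0).
have AE : map_mx intr A = T *: B' :> 'M[R]__ by rewrite scalerA divff ?scale1r ?gt_eqF.
have detAE : `|\det A|%:~R = T ^+ d.+1 * `|\det B'|.
  by rewrite intr_norm -det_map_mx AE detZ normrM gtr0_norm// exprn_gt0.
have covB' : covers th1 B'.
  rewrite -th1E; apply: (covers_perturb Bu B'u (ltW th00) (ltW f0) _ cov) => i j.
  rewrite -(mulmxV Bu) -mulmxBl.
  apply: le_trans (_ : d.+1%:R * (e * C) <= _).
    by apply: ler_norm_mulmx => // i' j'; have := AB i' j'; rewrite !mxE.
  rewrite mulrCA -ler_pdivlMr ?mulr_gt0//.
  by rewrite ge_min lexx orbT.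
exists A, (T * th1), al, p; split=> //; split.
- have : 0 < `|\det A|%:~R :> R by rewrite detAE mulr_gt0 ?exprn_gt0// (lt_trans k0).
  by rewrite ltr0z normr_gt0.
- by rewrite AE; apply: coversZ.
have powK : ((`|\det A|%:~R : R) `^ d.+1%:R^-1) ^+ d.+1 = `|\det A|%:~R.
  by rewrite -powR_mulrn ?powR_ge0// -powRrM mulVf ?pnatr_eq0// powRr1 ?ler0z.
have Tr0 : 0 <= T * (th1 / r) by rewrite !mulr_ge0 ?invr_ge0//; exact: ltW.
rewrite [ltRHS]mulrC -ltr_pdivrMr// -mulrA -(@ltr_pXn2r _ d.+1) ?nnegrE ?powR_ge0//.
by rewrite powK detAE exprMn ltr_pM2l ?exprn_gt0.
Qed.

End Approximation.

(** * Cost vectors proportional to the coefficients, and the sharpness (ii) *)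

(** Converse to [lvec_gt0]: with positive reduced costs, a minimizer must vanish outside [t], and
    the constraint then determines it. *)
Lemma generic_of_lvec (R : realType) n (a : 'cV[int]_n) (c : 'cV[rat]_n)
    (t : 'I_n) : positive_vec a -> (forall i, 0 < lvec a c t i 0) ->
  generic R a c /\ is_tau R a c t.
Proof.
move=> apos l_gt0; pose l := ratvec R (lvec a c t).
have l0 i : 0 < l i 0 by rewrite mxE ltr0q.
have lw i : 0 <= l i 0 by apply: ltW.
have at0 : 0 < (a t 0)%:~R :> R by rewrite ltr0z.
pose x b : 'cV[R]_n := insert t (b%:~R / (a t 0)%:~R) 0.
have xt b : x b t 0 = b%:~R / (a t 0)%:~R by rewrite insert_eq.
have xl b j : x b (lift t j) 0 = 0.
  by have /colP/(_ j) := row'_insert t (b%:~R / (a t 0)%:~R : R) 0; rewrite !mxE.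
have ax b : dot (intvec R a) (x b) = b%:~R.
  rewrite (dot_lift t) xt row'_insert mxE [X in _ + X]big1 => [|i _]; last first.
    by rewrite [X in _ * X]mxE mulr0.
  by rewrite addr0 mulrC divfK// gt_eqF.
have lx b : dot l (row' t (x b)) = 0.
  by apply: big1 => i _; rewrite [X in _ * X]mxE xl mulr0.
have xfeas b : 0 < b -> knapsack R a b (x b).
  move=> b0; split=> //; apply: (forall_lift (t := t)) => [|j]; last by rewrite xl.
  by rewrite xt divr_ge0 ?ltW// ltr0z.
have xopt b : 0 < b -> LP_optimal c a b (x b).
  move=> b0; split=> [|y [y0 ay]]; first exact: xfeas.
  rewrite (dot_reduced_cost c t apos (ax b)) (dot_reduced_cost c t apos ay) lx.
  by rewrite lerD2l; apply: sumr_ge0 => i _; rewrite mulr_ge0// mxE.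
have optE b y : 0 < b -> LP_optimal c a b y -> y = x b.
  move=> b0 [[y0 ay] ymin].
  have := ymin _ (xfeas b b0).
  rewrite (dot_reduced_cost c t apos (ax b)) (dot_reduced_cost c t apos ay) lx.
  rewrite lerD2l => ly.
  have ly0 i : 0 <= l i 0 * row' t y i 0 by rewrite mulr_ge0// mxE.
  have yl i : y (lift t i) 0 = 0.
    have /eqP : dot l (row' t y) = 0 by apply/eqP; rewrite eq_le ly sumr_ge0.
    rewrite psumr_eq0// => /allP/(_ i); rewrite mem_index_enum => /(_ isT).
    by rewrite /= mulf_eq0 gt_eqF//= mxE => /eqP.
  apply/colP; apply: (forall_lift (t := t)) => [|j]; last by rewrite yl xl.
  move: ay; rewrite xt (dot_lift t) [X in _ + X]big1 => [|i _]; last first.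
    by rewrite [X in _ * X]mxE yl mulr0.
  by rewrite addr0 mxE => <-; rewrite mulrAC divff ?mul1r// gt_eqF.
split=> [b b0|b b0 y /(optE _ _ b0)->].
  by exists (x b); split=> [|y /(optE _ _ b0)//]; exact: xopt.
apply: (forall_lift (t := t)) => [|j].
  by rewrite xt eqxx mulf_neq0 ?invr_eq0 ?(gt_eqF at0)// intr_eq0 gt_eqF.
by rewrite xl eqxx eq_sym (negbTE (neq_lift _ _)).
Qed.

Section ProportionalCost.
Context (d : nat) (m : int) (a' : 'cV[int]_d.+1).
Hypotheses (m0 : 0 < m) (a'0 : forall i, 0 < a' i 0).

Let a : 'cV[int]_d.+2 := insert ord0 m a'.
Let c : 'cV[rat]_d.+2 := insert ord0 0 (map_mx intr a').

Let row'a : row' ord0 a = a'. Proof. exact: row'_insert. Qed.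
Let a0 : a ord0 0 = m. Proof. exact: insert_eq. Qed.

Let apos : positive_vec a.
Proof.
apply: (forall_lift (t := ord0)) => [|j]; first by rewrite a0.
by have /colP/(_ j) := row'a; rewrite mxE => ->.
Qed.

Lemma lvec_proportional : lvec a c ord0 = map_mx intr a'.
Proof.
by rewrite /lvec row'_insert insert_eq mul0r scale0r subr0.
Qed.

(* As [l = a'], the group relaxation minimizes [a' x'] itself, so its optimum
   respects [a' x' <= b] as soon as some feasible point does. *)
Lemma gap_proportional_le (R : realType) (A : 'M[int]_d.+1) (W : int) (th dl : R) :
  0 < dl -> 0 <= W -> (forall i, a' i 0 <= W) -> covers th (map_mx intr A) ->
  (forall w, (m %| dot a' (A *m w)%R)%Z) ->
  (Gap R c a <= (W%:~R * th - (1 - dl) * (\sum_i a' i 0)%:~R)%:E)%E.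
Proof.
move=> dl0 W0 aW cov Am; set v := _ - _.
have lE : ratvec R (lvec a c ord0) = intvec R a'.
  by rewrite lvec_proportional; apply/colP => i; rewrite !mxE ratr_int.
have l0 i : 0 <= ratvec R (lvec a c ord0) i 0 by rewrite lE mxE ler0z ltW.
apply: ge_ereal_sup => _ [b [[u /(IP_valuesP c ord0 apos)[x [x0 <- _]]] _] <-].
pose x' := row' ord0 x.
(* After a shift by [1 - dl] the remainder is nonnegative, so the integers [x' - y] exceed -1 and
   are nonnegative. The shift is then subtracted from the cost, which yields the term
   [(1 - dl) * \sum_i a' i 0]. *)
have [w [k0 kth]] := cov (intvec R x' + const_mx (1 - dl)).
rewrite -intvecM in k0 kth; set y := A *m w in k0 kth.
have yE i : (intvec R x' + const_mx (1 - dl) - intvec R y) i 0 =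
    (x' i 0 - y i 0)%:~R + (1 - dl).
  by rewrite [x']lock !mxE -lock rmorphB/=; ring.
have xy0 i : 0 <= (x' - y) i 0.
  have := k0 i; rewrite yE -lerBlDr sub0r => h.
  rewrite [X in 0 <= X]mxE [(- y) i 0]mxE.
  have : (- 1)%:~R < (x' i 0 - y i 0)%:~R :> R by apply: lt_le_trans h; rewrite mulrN1z; lra.
  by rewrite ltr_int; move: (x' i 0 - y i 0) => k; lia.
have xyv : (dot a' (x' - y))%:~R <= v.
  have -> : (dot a' (x' - y))%:~R = \sum_i (a' i 0)%:~R *
      (intvec R x' + const_mx (1 - dl) - intvec R y) i 0
      - (1 - dl) * (\sum_i a' i 0)%:~R :> R.
    rewrite /dot !rmorph_sum /= mulr_sumr -sumrB; apply: eq_bigr => i _.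
    by rewrite yE rmorphM [(x' - y) i 0]mxE [(- y) i 0]mxE /=; ring.
  rewrite lerD2r; apply: le_trans (_ : W%:~R * \sum_i _ <= _).
    rewrite mulr_sumr; apply: ler_sum => i _.
    by apply: ler_wpM2r; [exact: k0|rewrite ler_int].
  by rewrite ler_wpM2l ?ler0z.
have dotx : dot a x = m * x ord0 0 + dot a' x' by rewrite (dot_lift ord0) row'a a0.
have [q qE] : exists q, dot a' y = q * m by apply/dvdzP; exact: Am.
have IGv (z : 'cV[int]_d.+2) : (forall i, 0 <= z i 0) -> dot a z = dot a x ->
    (dot a' (row' ord0 z))%:~R <= v -> (IG R c a (dot a x) <= v%:E)%E.
  move=> z0 <- zv; apply: le_trans (IG_le apos l0 z0) _.
  by rewrite lee_fin lE dot_intvec.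
(* If the budget allows, replace [x'] by [x' - y] and let the first coordinate absorb the multiple
   [q] of [m]; otherwise [x] itself is already cheap enough. *)
case: (lerP (dot a' (x' - y)) (dot a x)) => [le|lt].
  apply: (IGv (insert ord0 (x ord0 0 + q) (x' - y))).
  - apply: (forall_lift (t := ord0)) => [|j].
      move: le; rewrite insert_eq dotx dotBr qE.
      rewrite -(pmulr_rge0 (x ord0 0 + q) m0) -subr_ge0.
      by rewrite (_ : m * _ + _ - _ = m * (x ord0 0 + q))//; ring.
    by have /colP/(_ j) := row'_insert ord0 (x ord0 0 + q) (x' - y); rewrite mxE => ->.
  - by rewrite dotx (dot_lift ord0) row'a a0 insert_eq row'_insert dotBr qE; ring.
  - by rewrite row'_insert.
apply: (IGv x) => //; rewrite -/x'; apply: le_trans xyv.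
rewrite ler_int; apply: le_trans (ltW lt); rewrite dotx lerDr.
by rewrite mulr_ge0// ltW.
Qed.

End ProportionalCost.

Lemma gap_lt_exists (R : realType) d (eps : R) : 0 < eps ->
  exists (a : 'cV[int]_d.+2) (c : 'cV[rat]_d.+2) (t : 'I_d.+2),
    [/\ positive_vec a, gcd_vec a = 1%N, generic R a c, is_tau R a c t &
    let l := lvec a c t in
    (Gap R c a <
     ((rho R d.+1 + eps)
        * ratr ((a t 0)%:~R * \prod_(i < d.+1) l i 0) `^ (d.+1%:R)^-1
      - ratr (norm1 l))%:E)%E].
Proof.
move=> eps0; pose r := rho R d.+1 + eps / 2.
have [|A [th [al [p [[A0 cov thr] [alp aldvd]]]]]] := @rho_cyclic R d r.
  by rewrite ltrDl divr_gt0.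
pose m : int := `|\det A|; have m0 : 0 < m by rewrite normr_gt0.
set mu := _ `^ _ in thr.
(* The entries of [a'] will lie between [M * m] and [M.+1 * m]; this [M] lets the gap between [th]
   and [r * mu] absorb the ratio of these bounds. *)
pose M := (Num.bound (th / (r * mu - th))).+1.
have Mth : (M.+1)%:R * th <= M%:R * (r * mu).
  have h : 0 < r * mu - th by rewrite subr_gt0.
  have : th <= M%:R * (r * mu - th).
    rewrite -ler_pdivrMr// ltW// (lt_le_trans (archi_boundP _))// ?ler_nat//.
    by rewrite divr_ge0 ?(covers_ge0 cov) ?(ltW h).
  by rewrite -addn1 natrD; lra.
pose a' : 'cV[int]_d.+1 := \col_i ((al i 0%R %% m)%Z + M%:Z * m).
have a'E i : a' i 0 = (al i 0%R %% m)%Z + M%:Z * m by rewrite mxE.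
have a'ge i : M%:Z * m <= a' i 0 by rewrite a'E lerDr modz_ge0// gt_eqF.
have a'le i : a' i 0 <= M.+1%:Z * m.
  by rewrite a'E intS mulrDl mul1r lerD2r ltW// ltz_pmod.
have Mm0 : 0 < M%:Z * m by rewrite mulr_gt0.
have a'0 i : 0 < a' i 0 by apply: lt_le_trans (a'ge i).
clearbody a'.
have a'al x : exists q, dot a' x = dot al x + q * m.
  exists (\sum_i (M%:Z - (al i 0%R %/ m)%Z) * x i 0).
  rewrite /dot mulr_suml -big_split/=; apply: eq_bigr => i _.
  by rewrite a'E [X in _ = X * _ + _](divz_eq (al i 0) m); ring.
have Am w : (m %| dot a' (A *m w)%R)%Z.
  have [q ->] := a'al (A *m w).
  by rewrite rpredD ?dvdz_mull// dvdzE /m abszE -dvdzE abszE.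
have apos : positive_vec (insert ord0 m a').
  apply: (forall_lift (t := ord0)) => [|j]; first by rewrite insert_eq.
  by have /colP/(_ j) := row'_insert ord0 m a'; rewrite mxE => ->.
pose c : 'cV[rat]_d.+2 := insert ord0 0 (map_mx intr a').
have lE := lvec_proportional m a'; rewrite -/c in lE.
have l_gt0 i : 0 < lvec (insert ord0 m a') c ord0 i 0.
  by rewrite lE mxE ltr0z.
have [gen tau] := generic_of_lvec R apos l_gt0.
exists (insert ord0 m a'), c, ord0; split=> //.
  (* The gcd divides [m] and [dot a' p], which is 1 modulo [m] because [dot al p = 1]. *)
  apply/eqP; rewrite -dvdn1; set g := gcd_vec _.
  have ga i : (g %| (insert ord0 m a') i 0%R)%Z by exact: biggcdn_inf.
  have gm : (g %| m)%Z by have := ga ord0; rewrite insert_eq.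
  have [q qE] := a'al p.
  have : (g %| dot a' p - q * m)%Z.
    rewrite rpredB ?dvdz_mull//; apply: rpred_sum => i _; apply: dvdz_mulr.
    by have := ga (lift ord0 i); have /colP/(_ i) := row'_insert ord0 m a'; rewrite mxE => ->.
  by rewrite qE addrK alp.
rewrite lE insert_eq /=; set s := _ `^ _; set S := ratr _.
have SE : S = (\sum_i a' i 0)%:~R.
  rewrite /S /norm1 !rmorph_sum; apply: eq_bigr => i _ /=.
  by rewrite mxE ger0_norm ?ratr_int// ler0z ltW.
have S0 : 0 < S.
  rewrite SE ltr0z (bigD1 ord0)//= ltr_pwDl//; apply: sumr_ge0 => i _; exact: ltW.
have sE : s = (m%:~R * \prod_i (a' i 0)%:~R) `^ d.+1%:R^-1.
  rewrite /s rmorphM /= ratr_int rmorph_prod; congr ((_ * _) `^ _).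
  by apply: eq_bigr => i _; rewrite mxE /= ratr_int.
have mR : 0 < m%:~R :> R by rewrite ltr0z.
have Mmu : (M%:Z * m)%:~R * mu <= s.
  have -> : (M%:Z * m)%:~R * mu = (m%:~R * (M%:Z * m)%:~R ^+ d.+1) `^ d.+1%:R^-1.
    rewrite powRM ?exprn_ge0 ?ler0z ?(ltW m0) ?(ltW Mm0)// mulrC; congr (_ * _).
    by rewrite -powR_mulrn ?ler0z ?(ltW Mm0)// -powRrM mulfV ?pnatr_eq0// powRr1// ler0z ltW.
  rewrite sE; apply: ge0_ler_powR; rewrite ?invr_ge0 ?nnegrE ?ler0n//.
  - by rewrite mulr_ge0 ?exprn_ge0 ?ler0z ?(ltW m0) ?(ltW Mm0).
  - by rewrite mulr_ge0 ?prodr_ge0 ?ler0z ?(ltW m0)// => i _; rewrite ler0z ltW.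
  rewrite ler_wpM2l ?(ltW mR)// -[d.+1 in leLHS]card_ord -prodr_const.
  by apply: ler_prod => i _; rewrite ler0z ler_int a'ge ltW.
have mu0 : 0 < mu by rewrite powR_gt0.
have s0 : 0 < s by apply: lt_le_trans Mmu; rewrite mulr_gt0 ?ltr0z.
have r0 : 0 <= r.
  by rewrite -(pmulr_lge0 _ mu0) (le_trans (covers_ge0 cov))// ltW.
(* With this [dl] the loss [dl * S] is [eps / 4 * s], within the [eps / 2 * s] left between [r] and
   [rho + eps]. *)
have dl0 : 0 < eps / 4 * s / S by rewrite divr_gt0// mulr_gt0// divr_gt0.
have W0 : 0 <= M.+1%:Z * m by rewrite mulr_ge0// ltW.
apply: le_lt_trans (gap_proportional_le m0 a'0 dl0 W0 a'le cov Am) _.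
rewrite lte_fin -SE mulrBl mul1r divfK ?gt_eqF//.
have : (M.+1%:Z * m)%:~R * th <= r * s.
  apply: le_trans (_ : r * ((M%:Z * m)%:~R * mu) <= _); last by rewrite ler_wpM2l.
  rewrite !rmorphM /= -!pmulrn -mulrA (mulrCA _ m%:~R) -mulrA (mulrCA r) (mulrCA r).
  by rewrite (mulrCA M%:R) ler_pM2l.
have : 0 < eps * s by rewrite mulr_gt0.
rewrite /r; lra.
Qed.

Theorem theorem3 (R : realType) (n : nat) (hn : (2 <= n)%N) :
  (forall (a : 'cV[int]_n) (c : 'cV[rat]_n),
     positive_vec a -> gcd_vec a = 1%N -> generic R a c ->
     forall t : 'I_n, is_tau R a c t ->
     let l := lvec a c t in
     ((rho R n.-1
         * ratr ((a t 0)%:~R * \prod_(i < n.-1) l i 0) `^ (n.-1%:R)^-1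
       - ratr (norm1 l))%:E <= Gap R c a)%E)
  /\
  (forall eps : R, 0 < eps ->
     exists (a : 'cV[int]_n) (c : 'cV[rat]_n) (t : 'I_n),
       [/\ positive_vec a, gcd_vec a = 1%N, generic R a c, is_tau R a c t &
       let l := lvec a c t in
       (Gap R c a <
        ((rho R n.-1 + eps)
           * ratr ((a t 0)%:~R * \prod_(i < n.-1) l i 0) `^ (n.-1%:R)^-1
         - ratr (norm1 l))%:E)%E]).
Proof.
case: n hn => [|[|d]]// _; split=> [a c apos a1 gen t taut|eps eps0].
  exact: gap_ge apos a1 (lvec_gt0 apos gen taut).
exact: gap_lt_exists.
Qed.
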